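(* Let $r,s$ be integers with $1\le r\le s$ and let $p$ be a prime. Then the following are equivalent: (i) $\lambda(r,s,p)$ is a standard partition; (ii) $\pi(r,s,p)$ is the identity permutation; (iii) $(r,s,p)$ is a standard triple.
   Context: Write $[r]=\{1,\dots,r\}$. Let $N_\ell$ be the $\ell\times\ell$ matrix with $1$ in entries $(i,i+1)$, $1\le i<\ell$, and zeros elsewhere, and $J_\ell=I_\ell+N_\ell$ (unipotent Jordan block). For $1\le r\le s$ and a prime $p$, over any field of characteristic $p$ the Jordan canonical form of $J_r\otimes J_s$ is $\bigoplus_{i=1}^r J_{\lambda_i}$ with $\lambda_1\ge\cdots\ge\lambda_r>0$ and $\sum_i\lambda_i=rs$; the partition $\lambda(r,s,p):=(\lambda_1,\dots,\lambda_r)$ has exactly $r$ nonzero parts and depends only on $r,s,p$. The map $\pi(r,s,p):[r]\to[r]$ is the permutation $n\mapsto n^{\pi(r,s,p)}=(r+1-n)+s-\lambda_n$. The partition $\lambda(r,s,p)$ is called standard if $\lambda_n=r+s+1-2n$ for all $n\in[r]$. For an integer $n$ and a positive integer $\ell$, $n_{\bmod \ell}$ denotes the unique integer in $[0,\ell-1]$ congruent to $n$ modulo $\ell$. Let $m=\lceil\log_p(r)\rceil$. The triple $(r,s,p)$ is called standard if and only if one of the following holds: - $r=1$ ($p$ any prime); - $2\le r\le p$ ($p$ any prime) and $(s-r+1)_{\bmod p}\le p+2-2r$; - $p=2$, $r=3$ and $s\equiv 2\pmod 4$; - $p$ is odd, $r>p$, $a-h\in\{0,1\}$, $b-h\in\{0,1\}$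 and $2i+j\le p-1$, where $a:=r_{\bmod p^{m-1}}$, $b:=s_{\bmod p^{m-1}}$, $h:=\frac{p^{m-1}-1}{2}$, $i:=\left\lfloor\frac{r}{p^{m-1}}\right\rfloor$, $j:=\left\lfloor\frac{(s-r+1)_{\bmod p^m}}{p^{m-1}}\right\rfloor$. *)

(* Defs.v *)
From mathcomp Require Import all_boot all_order all_algebra.
From mathcomp Require Import mxtens.

Set Implicit Arguments.
Unset Strict Implicit.
Unset Printing Implicit Defensive.

Import Order.TTheory GRing.Theory Num.Theory.
Local Open Scope ring_scope.

Definition nilp_block (F : fieldType) (l : nat) : 'M[F]_l :=
  \matrix_(i, j) ((j : nat) == i.+1)%:R.

Definition jordan_block (F : fieldType) (l : nat) : 'M[F]_l :=
  1%:M + nilp_block F l.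

(* Parts are indexed from 0: lam i stands for lambda_{i+1}. The sizes of the
   two matrices are only propositionally equal, whence the cast. *)
Definition unipotent_jordan_form (F : fieldType) (n k : nat) (A : 'M[F]_n)
    (lam : 'I_k -> nat) : Prop :=
  [/\ forall i j : 'I_k, (i <= j)%N -> (lam j <= lam i)%N,
      forall i : 'I_k, (0 < lam i)%N
    & exists e : (\sum_(i < k) lam i)%N = n,
        A ~_{in unitmx}
          castmx (e, e) (\mxdiag_(i < k) jordan_block F (lam i)) ].

(* lam = lambda(r, s, p), computed over a field F of characteristic p; the
   Jordan form determines lam. *)
Definition is_tensor_partition (F : fieldType) (r s : nat)
    (lam : 'I_r -> nat) : Prop :=
  unipotent_jordan_form (jordan_block F r *t jordan_block F s) lam.

Definition standard_partition (r s : nat) (lam : 'I_r -> nat) : Prop :=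
  forall i : 'I_r, let n := i.+1 in
    (lam i)%:Z = r%:Z + s%:Z + 1 - 2 * n%:Z.

(* The value of pi(r, s, p) at n = i + 1, in the 1-based convention. It is an
   integer so that the subtractions are not truncated. *)
Definition tensor_pi (r s : nat) (lam : 'I_r -> nat) (i : 'I_r) : int :=
  let n := i.+1 in (r%:Z + 1 - n%:Z) + s%:Z - (lam i)%:Z.

Definition tensor_pi_is_id (r s : nat) (lam : 'I_r -> nat) : Prop :=
  forall i : 'I_r, let n := i.+1 in tensor_pi s lam i = n%:Z.

(* Meant for 1 <= r <= s and p prime. The bound p + 2 - 2r may be negative, so
   it is compared in int; the other differences are never truncated:
   s - r + 1 >= 1, and r > p gives m >= 2. *)
Definition standard_triple (r s p : nat) : Prop :=
  let m := up_log p r in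
  let q := (p ^ (m - 1))%N in
  let a := (r %% q)%N in
  let b := (s %% q)%N in
  let h := ((q - 1) %/ 2)%N in
  let i := (r %/ q)%N in
  let j := (((s - r + 1) %% p ^ m) %/ q)%N in
  [\/ r = 1%N,
      (2 <= r <= p)%N /\
        (((s - r + 1) %% p)%N%:Z <= p%:Z + 2 - 2 * r%:Z),
      [/\ p = 2%N, r = 3%N & (s = 2 %[mod 4])%N ]
    | [/\ odd p, (p < r)%N, a%:Z - h%:Z \in [:: 0; 1],
          b%:Z - h%:Z \in [:: 0; 1] & (2 * i + j <= p - 1)%N ] ].

(* Main.v *)
(* Index the standard basis of the tensor product by the monomials x^i y^j of
   F[x,y]/(x^r,y^s); then T = J_r (x) J_s - 1 is multiplication by x+y+xy, which
   raises the degree by at least one and has leading part x+y. For 1 <= n <= r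
   put k = r+s-2n: the leading part of T^k maps the degree n-1 component to the
   degree r+s-1-n component by the n x n matrix with entries C(k, r-n+j-i).

   Let D_n be its determinant. Since \rank T^k = sum_i (lam_i - k)_+, if lam is
   standard then T^k has rank n^2, which bounding the rank degree by degree
   forces D_n <> 0. Conversely, if D_1, ..., D_n <> 0 then ker T^k lives in
   degrees >= n, so \rank T^k - \rank T^(k+1) >= n, that is lam_n >= k+1; as the
   parts sum to rs, these inequalities are equalities.

   Over the integers D_n is MacMahon's product
   prod_(i < n) (r+s-2n+i)! i! / ((r-n+i)! (s-n+i)!). By Legendre's formula its
   p-adic valuation is a sum over q = p^e of nonnegative terms depending on
   r-n, s-n, n mod q, and the vanishing of all of them for all n in [1,r] is a
   condition on r and s modulo each q, which is then identified with the
   standard triples. *)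
Require Import Defs.
From mathcomp Require Import all_boot all_order all_algebra.
From mathcomp Require Import mxtens zify.
Import Order.TTheory GRing.Theory Num.Theory.

Set Implicit Arguments.
Unset Strict Implicit.
Unset Printing Implicit Defensive.

(** * Arithmetic *)

(** Summed over the powers [q = p ^ e] with [e > 0], this is the [p]-adic valuation of the product
    of the factorials of all [i < x]. *)
Definition floor_sum q x := \sum_(i < x) i %/ q.

Lemma floor_sum_small q x : x <= q -> floor_sum q x = 0.
Proof.
by move=> xq; apply: big1 => i _; rewrite divn_small // (leq_trans (ltn_ord i)).
Qed.

Lemma floor_sumD q x y :
  floor_sum q (x + y) = floor_sum q x + \sum_(i < y) (x + i) %/ q.
Proof. by rewrite /floor_sum big_split_ord. Qed.

Lemma floor_sum_period q x : 0 < q -> floor_sum q (x + q) = floor_sum q x + x.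
Proof.
move=> q0; rewrite addnC floor_sumD floor_sum_small // add0n.
under eq_bigr do rewrite divnDl // divnn q0 add1n -addn1.
by rewrite big_split /= sum_nat_const card_ord muln1.
Qed.

(** The truncated differences count the [i < x] with quotient at least 1 and at least 2. The range
    [x <= 3 * q] covers sums of three residues. *)
Lemma floor_sum_residue q x : 0 < q -> x <= 3 * q ->
  floor_sum q x = (x - q) + (x - 2 * q).
Proof.
move=> q0 x3.
have [xq|qx] := leqP x q; first by rewrite floor_sum_small //; lia.
have [x2|x2] := leqP x (2 * q).
  by rewrite -(subnK (ltnW qx)) floor_sum_period // floor_sum_small; lia.
rewrite -(subnK (ltnW qx)) floor_sum_period //.
have qx' : q <= x - q by lia.
by rewrite -(subnK qx') floor_sum_period // floor_sum_small; lia.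
Qed.

Definition box_good q a b c :=
  let: (x, y, z) := (a %% q, b %% q, c %% q) in
  [|| x == 0, y == 0, z == 0, x + y + z <= q | 2 * q <= x + y + z].

(* By Legendre's formula the difference of the two sides is the contribution of
   q = p^e to the p-adic valuation of MacMahon's box number for a x b x c. *)
Definition floor_leqif q a b c :=
  floor_sum q (a + b) + floor_sum q (a + c) + floor_sum q (b + c)
  <= floor_sum q (a + b + c) + floor_sum q a + floor_sum q b + floor_sum q c
  ?= iff box_good q a b c.

(** Both sides grow by [2 * a + b + c], and no residue changes. *)
Lemma floor_leqif_period q a b c : 0 < q ->
  floor_leqif q a b c -> floor_leqif q (a + q) b c.
Proof.
rewrite /floor_leqif /box_good modnDr => q0.
have -> : a + q + b = a + b + q by lia.
have -> : a + q + c = a + c + q by lia.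
have -> : a + b + q + c = a + b + c + q by lia.
rewrite !floor_sum_period // => -[le eq]; split; first by lia.
by rewrite -eq; apply/eqP/eqP; lia.
Qed.

Lemma floor_leqif_mod q a b c : 0 < q ->
  floor_leqif q (a %% q) b c -> floor_leqif q a b c.
Proof.
move=> q0 H; rewrite (divn_eq a q); elim: (a %/ q) => [|u IH]; first by rewrite add0n.
have -> : u.+1 * q + a %% q = u * q + a %% q + q by lia.
exact: floor_leqif_period.
Qed.

Lemma floor_leqifC q a b c : floor_leqif q a b c -> floor_leqif q b a c.
Proof.
rewrite /floor_leqif /box_good (addnC b a) (addnC (b %% q))
  [(a %% q == 0) || _]orbCA.
by rewrite [X in leqif X _ _]addnAC [X in leqif _ (X + _) _]addnAC.
Qed.

Lemma floor_leqifCA q a b c : floor_leqif q a b c -> floor_leqif q a c b.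
Proof.
rewrite /floor_leqif /box_good (addnC c b) (addnAC a c b) (addnAC (a %% q)).
rewrite [X in leqif (X + _) _ _]addnC [X in leqif _ X _]addnAC.
by rewrite [(b %% q == 0) || _]orbCA.
Qed.

(** Let [t = a + b + c]. If [t <= q] all terms vanish; if [2 * q <= t] all pair sums exceed [q] and
    both sides are [2 * t - 3 * q]. In between the right side is [t - q], and the left side is
    smaller unless one of the three numbers is 0. *)
Lemma floor_leqif_small q a b c : a < q -> b < q -> c < q -> floor_leqif q a b c.
Proof.
move=> aq bq cq; rewrite /floor_leqif /box_good !modn_small //.
have q0 : 0 < q by apply: leq_ltn_trans aq.
rewrite (floor_sum_small (ltnW aq)) (floor_sum_small (ltnW bq)).
rewrite (floor_sum_small (ltnW cq)) !addn0 (@floor_sum_residue q (a + b + c)) //; last by lia.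
have pairP x : x <= 2 * q -> exists2 y,
    floor_sum q x = y & (x <= q /\ y = 0) \/ (q < x /\ x = y + q).
  move=> x2; exists (floor_sum q x) => //.
  rewrite floor_sum_residue //; last by lia.
  have -> : x - 2 * q = 0 by lia.
  by rewrite addn0; have [xq|qx] := leqP x q; [left | right]; lia.
have [x -> xP] := pairP (a + b) ltac:(lia).
have [y -> yP] := pairP (a + c) ltac:(lia).
have [z -> zP] := pairP (b + c) ltac:(lia).
have [T1|T1] := leqP (a + b + c) q.
  have -> : a + b + c - q = 0 by lia.
  have -> : a + b + c - 2 * q = 0 by lia.
  have -> : x = 0 by lia.
  have -> : y = 0 by lia.
  have -> : z = 0 by lia.
  by rewrite orTb !orbT.
have [T2|T2] := leqP (2 * q) (a + b + c).
  have -> : a + b + c - q + (a + b + c - 2 * q) = x + y + z by lia.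
  by rewrite !orbT; split; rewrite ?eqxx.
have -> : a + b + c - 2 * q = 0 by lia.
rewrite addn0 !orbF; apply/leqifP.
have [a0|a0] := posnP a; first by rewrite a0; apply/eqP; lia.
have [b0|b0] := posnP b; first by rewrite b0 orbT; apply/eqP; lia.
have [c0|c0] := posnP c; first by rewrite c0 !orbT; apply/eqP; lia.
by rewrite /=; lia.
Qed.

(** Symmetry brings each argument to the front in turn, to be reduced modulo [q]. *)
Lemma floor_leqifP q a b c : 0 < q -> floor_leqif q a b c.
Proof.
move=> q0; apply: floor_leqif_mod => //; apply: floor_leqifC.
apply: floor_leqif_mod => //; apply: floor_leqifCA; apply: floor_leqifC.
apply: floor_leqif_mod => //; apply: floor_leqif_small; exact: ltn_pmod.
Qed.

(** * Legendre's formula for MacMahon's product *)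

(** A common range of exponents lets the valuations of different factorials be added termwise; the
    extra terms vanish because [n < p ^ e]. *)
Lemma logn_fact_bound p n m : prime p -> n <= m ->
  logn p n`! = \sum_(1 <= e < m.+1) n %/ p ^ e.
Proof.
move=> pp nm; rewrite logn_fact // [RHS](@big_cat_nat _ _ _ n.+1) //=.
rewrite [X in _ = _ + X]big_nat_cond [X in _ = _ + X]big1 ?addn0 // => e.
rewrite andbT => /andP[ne _]; apply: divn_small.
by apply: (leq_trans ne); apply/ltnW/ltn_expl/prime_gt1.
Qed.

Lemma logn_prod (I : Type) (s : seq I) (f : I -> nat) p :
  (forall i, 0 < f i) -> logn p (\prod_(i <- s) f i) = \sum_(i <- s) logn p (f i).
Proof.
move=> f0; elim: s => [|i s IH]; first by rewrite !big_nil logn1.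
by rewrite !big_cons lognM ?IH ?prodn_gt0.
Qed.

Lemma leqif_telescope ab ac bc abc a b c C :
  a <= ac -> b <= bc -> ab <= abc ->
  ab + ac + bc <= abc + a + b + c ?= iff C ->
  ac - a + (bc - b) <= abc - ab + c ?= iff C.
Proof.
move=> Ma Mb Mab [le <-]; split; first by lia.
by apply/eqP/eqP; lia.
Qed.

(** The hypothesis is MacMahon's product formula for [D] with denominators cleared. The valuation of
    [D] is then a sum of nonnegative gaps, one for each power of [p], so it is 0 exactly when every
    gap closes. *)
Lemma box_logn p a b c D : prime p ->
  D * (\prod_(i < c) (a + i)`! * \prod_(i < c) (b + i)`!)
    = \prod_(i < c) (a + b + i)`! * \prod_(i < c) i`! ->
  ~~ (p %| D) <-> forall e, 0 < e -> box_good (p ^ e) a b c.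
Proof.
move=> pp HD.
have D0 : 0 < D.
  rewrite lt0n; apply/eqP => D0; move/eqP: HD; rewrite D0 mul0n eq_sym muln_eq0.
  by rewrite !gtn_eqF // prodn_gt0 // => i; apply: fact_gt0.
have f0 x : forall i : 'I_c, 0 < (x + i)`! by move=> i; apply: fact_gt0.
pose m := a + b + c.
have L x : x + c <= m -> logn p (\prod_(i < c) (x + i)`!) =
   \sum_(1 <= e < m.+1) (floor_sum (p ^ e) (x + c) - floor_sum (p ^ e) x).
  move=> xm; rewrite logn_prod //.
  have xim (i : 'I_c) : x + i <= m by move: (ltn_ord i); lia.
  under eq_bigr => i _ do rewrite (logn_fact_bound pp (xim i)).
  by rewrite exchange_big; apply: eq_bigr => e _; rewrite floor_sumD addKn.
have L0 : logn p (\prod_(i < c) i`!) = \sum_(1 <= e < m.+1) floor_sum (p ^ e) c.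
  rewrite (L 0); last by lia.
  by apply: eq_bigr => e _; rewrite (@floor_sum_small _ 0) ?subn0.
move/(congr1 (logn p)): HD.
rewrite !lognM ?muln_gt0 ?prodn_gt0 //; try by move=> i; apply: fact_gt0.
rewrite L0 !L; try by lia.
rewrite -!big_split /= => HD.
have M x e : floor_sum (p ^ e) x <= floor_sum (p ^ e) (x + c).
  by rewrite floor_sumD leq_addr.
pose E1 e := (floor_sum (p ^ e) (a + c) - floor_sum (p ^ e) a +
             (floor_sum (p ^ e) (b + c) - floor_sum (p ^ e) b)).
pose E2 e := (floor_sum (p ^ e) (a + b + c) - floor_sum (p ^ e) (a + b)
             + floor_sum (p ^ e) c).
have pe0 e : 0 < p ^ e by rewrite expn_gt0 prime_gt0.
have LE e : E1 e <= E2 e ?= iff box_good (p ^ e) a b c.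
  by apply: leqif_telescope (M _ _) (M _ _) (M _ _) _; exact: floor_leqifP.
have pD : (p %| D) = (0 < logn p D) by rewrite logn_gt0 mem_primes pp D0.
have S := @leqif_sum 'I_m xpredT (fun e => box_good (p ^ e.+1) a b c)
   (fun e => E1 e.+1) (fun e => E2 e.+1) (fun e _ => LE e.+1).
move: HD; rewrite !big_add1 /= !big_mkord => HD.
have -> : ~~ (p %| D) = [forall (e : 'I_m | true), box_good (p ^ e.+1) a b c].
  by rewrite pD -S.2 /E1 /E2 -HD -leqNgt leqn0 -[X in _ = (X == _)]add0n eqn_add2r eq_sym.
split=> [/forallP H [//|e] _|H]; last by apply/forallP => e; apply: H.
have [em|me] := ltnP e m; first exact: (H (Ordinal em)).
(* Past the range of summation the residues are [a], [b], [c] themselves, with sum at most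
   [p ^ e.+1]. *)
have pe : m < p ^ e.+1 by apply: leq_ltn_trans me _; apply/ltnW/ltn_expl/prime_gt1.
by rewrite /box_good !modn_small; move: pe; rewrite /m; lia.
Qed.

(** * The condition on r and s modulo one prime power *)

(** For [q <= r] the numbers [n] in [[1, r]] meet every nonzero residue, whence four inequalities;
    for [r < q] only [n <= r] occur, and two remain. *)
Definition shape_good q r s :=
  let: (x, y) := (r %% q, s %% q) in
  if q <= r then
    [&& x <= y.+1, y <= x.+1, x + y <= q.+1 & q <= (x + y).+1]
  else (r <= y.+1) && (r + y <= q.+1).

Lemma modnB_case q x y : y < q -> y <= x ->
  (x - y) %% q = if y <= x %% q then x %% q - y else x %% q + q - y.
Proof.
move=> yq yx; have q0 : 0 < q by lia.
have xq := ltn_pmod x q0.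
have e := divn_eq x q; case: leqP => yX.
  have -> : x - y = x %/ q * q + (x %% q - y) by lia.
  by rewrite modnMDl modn_small //; lia.
have -> : x - y = (x %/ q).-1 * q + (x %% q + q - y).
  by case: (x %/ q) e => [|u] /=; lia.
by rewrite modnMDl modn_small //; lia.
Qed.

Lemma shape_goodP q r s : 1 < q -> 0 < r <= s ->
  shape_good q r s <->
  forall n, 0 < n <= r -> box_good q (r - n) (s - n) n.
Proof.
move=> q1 /andP[r0 rs]; have q0 : 0 < q by lia.
have xq := ltn_pmod r q0; have yq := ltn_pmod s q0.
have B c : 0 < c < q -> c <= r -> box_good q (r - c) (s - c) c =
  let: (x, y) := (r %% q, s %% q) in
  let u := if c <= x then x - c else x + q - c in
  let v := if c <= y then y - c else y + q - c in
  [|| u == 0, v == 0, c == 0, u + v + c <= q | 2 * q <= u + v + c].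
  move=> /andP[c0 cq] cr.
  by rewrite /box_good !modnB_case ?(modn_small cq) //; lia.
(* Only [n %% q] matters, and multiples of [q] are always good, so [n < q] may be assumed. *)
have -> : (forall n, 0 < n <= r -> box_good q (r - n) (s - n) n) <->
  (forall c, 0 < c < q -> c <= r -> box_good q (r - c) (s - c) c).
  split=> H c /andP[c0]; first by move=> _ cr; apply: H; rewrite c0.
  move=> cr.
  have [cq|cq] := posnP (c %% q); first by rewrite /box_good cq eqxx !orbT.
  have M x : c <= x -> (x - c) %% q = (x - c %% q) %% q.
    move=> cx; have -> : x - c %% q = c %/ q * q + (x - c).
      by move: (divn_eq c q) cx; move: (c %/ q * q) (c %% q) => u v; lia.
    by rewrite modnMDl.
  have -> : box_good q (r - c) (s - c) c = box_good q (r - c %% q) (s - c %% q) (c %% q).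
    by rewrite /box_good !M ?modn_mod //; lia.
  by apply: H; rewrite ?cq ?ltn_pmod // (leq_trans (leq_mod _ _) cr).
rewrite /shape_good; split=> [H c c0q cr | H].
  rewrite B //; move: H c0q cr xq yq; have [qr|rq] := leqP q r.
    move: (r %% q) (s %% q) => x y; case: (leqP c x); case: (leqP c y); lia.
  rewrite (modn_small rq); move: (s %% q) => y; case: (leqP c r); case: (leqP c y); lia.
have {}H c : 0 < c < q -> c <= r ->
  let: (x, y) := (r %% q, s %% q) in
  let u := if c <= x then x - c else x + q - c in
  let v := if c <= y then y - c else y + q - c in
  [|| u == 0, v == 0, c == 0, u + v + c <= q | 2 * q <= u + v + c].
  by move=> cq cr; rewrite -B // H.
have [qr|rq] := leqP q r.
  have {}H c : 0 < c < q -> _ := fun cq => H c cq (leq_trans (ltnW (andP cq).2) qr).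
  move: H xq yq; move: (r %% q) (s %% q) => x y H xq yq.
  (* Each inequality, if violated, is refuted by a single [n]: just past [y], just past [x], then 1,
     then [q - 1]. *)
  apply/and4P; split; apply: contraT; rewrite -ltnNge => lt.
  - by move: (H y.+1); case: (leqP y.+1 x); case: (leqP y.+1 y); lia.
  - by move: (H x.+1); case: (leqP x.+1 x); case: (leqP x.+1 y); lia.
  - by move: (H 1); case: (leqP 1 x); case: (leqP 1 y); lia.
  - by move: (H q.-1); case: (leqP q.-1 x); case: (leqP q.-1 y); lia.
move: H; rewrite (modn_small rq); move: (s %% q) yq => y yq H.
apply/andP; split; apply: contraT; rewrite -ltnNge => lt.
- by move: (H y.+1); case: (leqP y.+1 r); case: (leqP y.+1 y); lia.
- by move: (H 1); case: (leqP 1 r); case: (leqP 1 y); lia.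
Qed.

Definition tail_good q r s := (r <= (s %% q).+1) && (r + s %% q <= q.+1).

(** At the boundary [r = q] the residue of [r] is 0, and both tests say [q - 1 <= s %% q <= 1]. *)
Lemma shape_good_tail q r s : 1 < q -> 0 < r <= q ->
  shape_good q r s = tail_good q r s.
Proof.
move=> q1 /andP[r0 rq]; rewrite /shape_good /tail_good.
have [qr|//] := leqP q r.
  have -> : r = q by lia.
  by rewrite modnn; lia.
Qed.

(** With [y = s %% q], the residue of [s - (r - 1)] is [y - (r - 1)], which gives [r + y <= q + 1],
    or it wraps around, and then both sides fail. *)
Lemma tail_goodP q r s : 0 < r <= s -> r <= q ->
  tail_good q r s = ((s - r + 1) %% q + 2 * r <= q + 2).
Proof.
move=> /andP[r0 rs] rq; have q0 : 0 < q by lia.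
have yq := ltn_pmod s q0; rewrite /tail_good.
have -> : s - r + 1 = s - r.-1 by lia.
by rewrite modnB_case; try lia; case: (leqP r.-1 (s %% q)); lia.
Qed.

(** Among the powers of [p] that are at least [r], only the smallest matters: passing to [q'] adds
    to [s %% q] a multiple of [q] that is at most [q' - q]. *)
Lemma tail_good_dvd q q' r s : r <= q -> 0 < q' -> q %| q' ->
  tail_good q r s -> tail_good q' r s.
Proof.
rewrite /tail_good => rq q'0 dv; rewrite -(modn_dvdm s dv).
have := ltn_pmod s q'0; have [w ->] := dvdnP dv; have {dv q'0} := dvdnP dv.
move: (s %% _) => y _ lt.
have q0 : 0 < q by case: (q) lt => //; rewrite muln0.
have := divn_eq y q; have : y %/ q < w by rewrite ltn_divLR.
move: (y %/ q) (y %% q) => u v uw.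
have : u.+1 * q <= w * q by rewrite leq_mul2r uw orbT.
by rewrite mulSn; move: (u * q) (w * q); lia.
Qed.

(** As [q = 2 * h + 1], the four inequalities cut out exactly the square of residues in
    [{h, h + 1}]. *)
Lemma shape_good_odd q r s : odd q -> 0 < q <= r ->
  let h := (q - 1) %/ 2 in
  shape_good q r s = [&& h <= r %% q, r %% q <= h.+1, h <= s %% q & s %% q <= h.+1].
Proof. by move=> oq /andP[q0 qr] /=; rewrite /shape_good qr; lia. Qed.

(** Among the odd powers not exceeding [r] the largest one decides: for [q' = w * q] with [w] odd,
    [(q' - 1) / 2] reduces to [(q - 1) / 2] modulo [q]. *)
Lemma shape_good_odd_dvd q q' r s : odd q' -> 0 < q' <= r -> q %| q' -> 1 < q ->
  shape_good q' r s -> shape_good q r s.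
Proof.
move=> oq' /andP[q'0 q'r] dv q1.
have oq : odd q by apply: dvdn_odd dv oq'.
have qq' : q <= q' by apply: dvdn_leq.
rewrite !shape_good_odd ?q'0 ?(ltnW q1) ?(leq_trans qq') //.
rewrite -(modn_dvdm r dv) -(modn_dvdm s dv).
have [w wE] := dvdnP dv; have ow : odd w by move: oq'; rewrite wE oddM => /andP[].
have hE : (q' - 1) %/ 2 = w %/ 2 * q + (q - 1) %/ 2.
  rewrite wE; have -> : w = (w %/ 2).*2.+1 by lia.
  move: (w %/ 2) => u; have -> : u.*2.+1 %/ 2 = u by lia.
  have := odd_double_half q; rewrite (dvdn_odd dv oq') => <-.
  rewrite mulSn -doubleMl.
  by move: (u * _); lia.
have K z : (q' - 1) %/ 2 <= z -> z <= ((q' - 1) %/ 2).+1 ->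
    (q - 1) %/ 2 <= z %% q <= ((q - 1) %/ 2).+1.
  move=> z1 z2.
  have -> : z = w %/ 2 * q + ((q - 1) %/ 2 + (z - (q' - 1) %/ 2)).
    by move: z1 hE; move: (_ %/ 2 * q) => u; lia.
  by rewrite modnMDl modn_small; lia.
by move=> /and4P[r1 r2 s1 s2]; rewrite (andP (K _ r1 r2)).1 (andP (K _ r1 r2)).2 K.
Qed.

(** Write [r = i * Q + a] and [s %% (p * Q) = k * Q + b]. Since [a] and [b] are near [Q / 2], the
    left side says [i <= k] and [i + k < p]; the quotient on the right is [k - i], or [k - i + p]
    when [k < i], which makes the inequality fail. *)
Lemma tail_good_odd p Q r s : 2 < Q -> 0 < r <= s -> r <= p * Q ->
  let h := (Q - 1) %/ 2 in
  h <= r %% Q <= h.+1 -> h <= s %% Q <= h.+1 -> odd Q ->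
  tail_good (p * Q) r s = (2 * (r %/ Q) + ((s - r + 1) %% (p * Q)) %/ Q <= p - 1).
Proof.
move=> Q2 /andP[r0 rs] rP h aH bH oQ.
have Q0 : 0 < Q by lia.
have P0 : 0 < p * Q by lia.
have p0 : 0 < p by lia.
rewrite /tail_good; have -> : s - r + 1 = s - r.-1 by lia.
rewrite modnB_case; try lia.
have := ltn_pmod s P0; rewrite -ltn_divLR //.
move: bH; rewrite -(@modn_dvdm (p * Q) s Q) ?dvdn_mull //.
move: (s %% (p * Q)) => Y bH kp; have yE := divn_eq Y Q.
have ip : r %/ Q <= p by rewrite -(mulnK p Q0); apply: leq_div2r.
have {r0 rs rP} rE := divn_eq r Q; rewrite [in X in X && _]rE [in X in _ && X]rE.
rewrite [in X in if X then _ else _]rE [in X in if _ then X else _]rE.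
rewrite [in X in if _ then _ else X]rE.
move: (r %/ Q) (r %% Q) (Y %/ Q) (Y %% Q) ip kp aH bH yE => {r rE} i a k b ip kp aH bH ->.
(* Here [b + 1 - a] is 0, 1 or 2, hence less than [Q]: no carry. *)
have Qdiv u : (u * Q + (b.+1 - a)) %/ Q = u.
  by rewrite divnMDl // divn_small ?addn0 //; lia.
have [ik|ki] := leqP i k.
  have := leq_mul2r Q i k; rewrite ik orbT => ikQ.
  rewrite ifT; last by lia.
  have -> : k * Q + b - (i * Q + a).-1 = (k - i) * Q + (b.+1 - a) by rewrite mulnBl; lia.
  rewrite Qdiv; have [np|pn] := ltnP (i + k) p.
    have : (i + k).+1 * Q <= p * Q by rewrite leq_mul2r np orbT.
    by rewrite mulSn mulnDl; lia.
  have : p * Q <= (i + k) * Q by rewrite leq_mul2r pn orbT.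
  by rewrite mulnDl; lia.
have kiQ : k.+1 * Q <= i * Q by rewrite leq_mul2r ki orbT.
rewrite mulSn in kiQ.
have ipQ : i * Q <= p * Q by rewrite leq_mul2r ip orbT.
rewrite ifF; last by lia.
have -> : k * Q + b + p * Q - (i * Q + a).-1 = (k + (p - i)) * Q + (b.+1 - a).
  by rewrite mulnDl mulnBl; lia.
by rewrite Qdiv; lia.
Qed.

(** * All powers of p at once, and the standard triples *)

Lemma shape_good_small p r s : 1 < p -> 0 < r <= s -> r <= p ->
  (forall e, 0 < e -> shape_good (p ^ e) r s)
  <-> (s - r + 1) %% p + 2 * r <= p + 2.
Proof.
move=> p1 rs rp; have r0 : 0 < r by case/andP: rs.
rewrite -tail_goodP //; split=> [/(_ 1 isT)|H e e0].
  by rewrite expn1 shape_good_tail ?r0.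
have pe : p <= p ^ e by rewrite -{1}(expn1 p) leq_pexp2l // ltnW.
rewrite shape_good_tail ?(leq_trans p1) ?r0 ?(leq_trans rp) //.
apply: (@tail_good_dvd p) => //; first by rewrite expn_gt0 ltnW.
by rewrite -{1}(expn1 p) dvdn_exp2l.
Qed.

(** The powers 4 and 8 together exclude [r >= 4], and for [r = 3] the power 4 fixes [s] modulo 4. *)
Lemma shape_good_two r s : 2 < r <= s ->
  (forall e, 0 < e -> shape_good (2 ^ e) r s) <-> r = 3 /\ s = 2 %[mod 4].
Proof.
move=> /andP[r2 rs]; split=> [H|[rE s4] e].
  move: (H 2 isT) (H 3 isT); rewrite /shape_good (_ : 2 ^ 2 = 4) // (_ : 2 ^ 3 = 8) //.
  by case: (leqP 4 r); case: (leqP 8 r); lia.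
case: e => [//|[|e]] _; first by rewrite /shape_good rE expn1 /=; lia.
have e4 : 4 %| 2 ^ e.+2 by apply: (@dvdn_exp2l 2 2).
have e40 : 4 <= 2 ^ e.+2 by apply: dvdn_leq; rewrite ?expn_gt0.
rewrite shape_good_tail; try lia.
by apply: (@tail_good_dvd 4) => //; rewrite ?rE ?expn_gt0 // /tail_good; lia.
Qed.

(** Two powers decide: [q < r <= p ^ m] are consecutive, the condition at [q] implies those below
    it, and the one at [p ^ m] implies those above it. *)
Lemma shape_good_large p r s : odd p -> 1 < p -> p < r <= s ->
  let m := up_log p r in
  let q := p ^ (m - 1) in
  let h := (q - 1) %/ 2 in
  (forall e, 0 < e -> shape_good (p ^ e) r s) <->
  [/\ h <= r %% q <= h.+1, h <= s %% q <= h.+1 &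
      2 * (r %/ q) + ((s - r + 1) %% p ^ m) %/ q <= p - 1].
Proof.
move=> op p1 /andP[pr rs] m q h.
have p0 := ltnW p1.
have r1 : 1 < r by lia.
have /andP[qr rpm] := up_log_bounds p1 r1; rewrite -/m in qr rpm.
have m2 : 1 < m.
  move: rpm; rewrite ltnNge; apply: contraL.
  by case: (m) => [|[|]] // _; rewrite ?expn0 ?expn1; lia.
have pmE : p ^ m = p * q by rewrite /q -expnS; congr (_ ^ _); lia.
have {}qr : q < r by rewrite /q subn1.
have q2 : 2 < q.
  have : p <= q by rewrite -{1}(expn1 p) leq_pexp2l //; lia.
  by move: op p1; lia.
have oq : odd q by rewrite oddX op orbT.
have qodd e : 0 < e < m -> shape_good q r s -> shape_good (p ^ e) r s.
  move=> /andP[e0 em]; apply: shape_good_odd_dvd => //; first by lia.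
    by apply: dvdn_exp2l; lia.
  by rewrite -(expn0 p) ltn_exp2l.
have pe1 e : 0 < e -> 1 < p ^ e by move=> e0; rewrite -(expn0 p) ltn_exp2l.
have rP : r <= p * q by rewrite -pmE.
have q0r : 0 < q <= r by rewrite (ltnW qr) (ltn_trans _ q2).
have r0 : 0 < r := ltnW r1.
have r0s : 0 < r <= s by rewrite r0.
have m0 : 0 < m := ltnW m2.
have TG := @tail_good_odd p q r s q2 r0s rP.
split=> [H|[rq sq J]].
  have : shape_good q r s by apply: H; rewrite subn_gt0.
  rewrite (shape_good_odd _ oq q0r) => /and4P[a1 a2 a3 a4].
  split; [exact/andP | exact/andP |].
  rewrite pmE -TG //; try exact/andP.
  rewrite -pmE -shape_good_tail ?pe1 //; first exact: H.
  by rewrite r0.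
have Sq : shape_good q r s.
  by rewrite (shape_good_odd _ oq q0r); case/andP: rq => -> ->; case/andP: sq => -> ->.
move=> e e0; have [em|me] := ltnP e m; first by apply: qodd => //; rewrite e0.
have rpe : r <= p ^ e by apply: leq_trans rpm _; rewrite leq_pexp2l.
rewrite shape_good_tail ?pe1 //; last by rewrite r0.
apply: (@tail_good_dvd (p ^ m)) => //; first by rewrite expn_gt0 p0.
  by rewrite dvdn_exp2l.
by rewrite pmE TG // -pmE.
Qed.

Lemma mem_subz01 (a h : nat) :
  (a%:Z - h%:Z \in [:: 0; 1])%R = (h <= a <= h.+1).
Proof. by rewrite !inE; lia. Qed.

Lemma standard_tripleP p r s : prime p -> 0 < r <= s ->
  standard_triple r s p <-> forall e, 0 < e -> shape_good (p ^ e) r s.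
Proof.
move=> pp rs; have p1 := prime_gt1 pp.
have [rp|pr] := leqP r p.
  rewrite shape_good_small // /standard_triple; split.
    case=> [-> | [_ H] | [p2 r3 _] | [_ pr _ _ _]]; [|lia..].
    by rewrite leq_add2r ltnW // ltn_pmod // ltnW.
  move=> H; have [r1|r1] := leqP r 1; first by apply: Or41; lia.
  by apply: Or42; split; [exact/andP | lia].
have {}prs : p < r <= s by rewrite pr; case/andP: rs.
have [p2|op] := even_prime pp.
  rewrite {pr}p2 in prs *; rewrite shape_good_two // /standard_triple; split.
    by case=> [|[]|[]|[]] //; lia.
  by move=> [-> ?]; apply: Or43.
rewrite shape_good_large // /standard_triple; split.
  case=> [|[]|[]|[_ _ a b ij]]; try lia.
  by rewrite -!mem_subz01.
by move=> [a b ij]; apply: Or44; rewrite op pr !mem_subz01.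
Qed.

(** * Linear algebra *)

Local Open Scope ring_scope.

(** * Determinants of binomial matrices *)

(** The test is needed because the truncated [a + j - i] would give the binomial coefficient 1
    instead of 0. *)
Definition binom_mx (R : nzRingType) a b n : 'M[R]_n :=
  \matrix_(i, j) (if (i <= a + j)%N then 'C(a + b, a + j - i) else 0%N)%:R.

Lemma det_pascal (R : comNzRingType) n :
  \det (\matrix_(i < n, j < n) 'C(i, j)%:R : 'M[R]_n) = 1.
Proof.
rewrite det_trig; first by rewrite big1 // => i _; rewrite mxE binn.
by apply/is_trig_mxP => i j ij; rewrite mxE bin_small.
Qed.

Lemma sum_binom_shift n (i : 'I_n) m c :
  (\sum_(k < n) 'C(i, k) * (if k <= m then 'C(c, m - k) else 0) = 'C(i + c, m))%N.
Proof.
pose f k := ('C(i, k) * (if k <= m then 'C(c, m - k) else 0))%N.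
rewrite -binomial.Vandermonde -(big_mkord xpredT f).
rewrite -(big_mkord xpredT (fun k => 'C(i, k) * 'C(c, m - k))%N).
(* Terms beyond [i] vanish, so the range can be moved from [n] to one that also contains [m]. *)
have E t : (i < t)%N -> (\sum_(0 <= k < t) f k = \sum_(0 <= k < i.+1) f k)%N.
  move=> it; rewrite (@big_cat_nat _ _ _ i.+1) //= [X in (_ + X)%N]big_nat_cond.
  rewrite [X in (_ + X)%N]big1 ?addn0 // => k /andP[/andP[ik _] _].
  by rewrite /f bin_small.
rewrite E ?ltn_ord // -(E (maxn i.+1 m.+1)) ?leq_maxl //.
rewrite (@big_cat_nat _ _ _ m.+1) ?leq_maxr //= [X in (_ + X)%N]big_nat_cond.
rewrite [X in (_ + X)%N]big1 ?addn0; last first.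
  by move=> k /andP[/andP[mk _] _]; rewrite /f leqNgt mk muln0.
by apply: eq_big_nat => k; rewrite ltnS /f => /andP[_ ->].
Qed.

(** Left multiplication by the unitriangular Pascal matrix turns each column into a Vandermonde
    convolution. *)
Lemma det_binom_mx_pascal (R : comNzRingType) a b n :
  \det (binom_mx R a b n) = \det (\matrix_(i < n, j < n) 'C(a + b + i, a + j)%:R).
Proof.
rewrite -[LHS]mul1r -[X in X * _ = _](@det_pascal R n) -det_mulmx; congr (\det _).
apply/matrixP => i j; rewrite !mxE.
under eq_bigr => k _ do rewrite !mxE -natrM.
by rewrite -natr_sum sum_binom_shift (addnC i).
Qed.

(** This is the case [a = 0] of the previous identity, where [binom_mx] is unitriangular. *)
Lemma det_binom_rising (R : comNzRingType) b n :
  \det (\matrix_(i < n, j < n) 'C(b + i, j)%:R : 'M[R]_n) = 1.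
Proof.
transitivity (\det (binom_mx R 0 b n)).
  by rewrite det_binom_mx_pascal.
rewrite -det_tr det_trig; first by rewrite big1 // => i _; rewrite !mxE leqnn subnn bin0.
by apply/is_trig_mxP => i j ij; rewrite !mxE leqNgt ij.
Qed.

Lemma det_scale_rows_cols (R : comNzRingType) n (A B : 'M[R]_n) (r c r' c' : 'I_n -> R) :
  (forall i j, A i j * (c j * r i) = r' i * c' j * B i j) ->
  \det A * ((\prod_i c i) * \prod_i r i) = (\prod_i r' i) * (\prod_i c' i) * \det B.
Proof.
move=> H.
have E : diag_mx (\row_i r i) *m A *m diag_mx (\row_i c i)
       = diag_mx (\row_i r' i) *m B *m diag_mx (\row_i c' i).
  apply/matrixP => i j; rewrite !mul_mx_diag !mul_diag_mx !mxE.
  by rewrite [RHS]mulrAC -H -mulrA mulrC -mulrA.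
have D (f : 'I_n -> R) : \det (diag_mx (\row_i f i)) = \prod_i f i.
  by rewrite det_diag; apply: eq_bigr => i _; rewrite mxE.
move/(congr1 determinant): E; rewrite !det_mulmx !D => E.
by rewrite mulrA mulrC mulrA [RHS]mulrAC.
Qed.

(** MacMahon's formula: after clearing factorials row by row and column by column,
    ['C(a + b + i, a + j)] becomes ['C(b + i, j)], whose matrix has determinant 1. *)
Lemma binom_mx_int_det a b n :
  \det (binom_mx int a b n)
    * ((\prod_(i < n) (a + i)`!)%N%:R * (\prod_(i < n) (b + i)`!)%N%:R)
  = (\prod_(i < n) (a + b + i)`!)%N%:R * (\prod_(i < n) i`!)%N%:R.
Proof.
rewrite det_binom_mx_pascal !natr_prod.
rewrite (@det_scale_rows_cols _ _ _ (\matrix_(i < n, j < n) 'C(b + i, j)%:R)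
  _ _ (fun i => (a + b + i)`!%:R) (fun i => i`!%:R)) ?det_binom_rising ?mulr1 // => i j.
rewrite !mxE -!natrM; congr _%:R.
have [ji|ij] := leqP j (b + i); last first.
  by rewrite !bin_small ?muln0 // -addnA ltn_add2l.
have ab : (a + j <= a + b + i)%N by rewrite -addnA leq_add2l.
have := bin_fact ab; rewrite -addnA subnDl => <-.
by rewrite -(bin_fact ji) -!mulnA; do 2 congr muln; rewrite mulnC -mulnA mulnCA.
Qed.

Lemma unitmx_binom_mx (F : fieldType) p a b n : p \in [pchar F] ->
  binom_mx F a b n \in unitmx <-> forall e, (0 < e)%N -> box_good (p ^ e) a b n.
Proof.
move=> cF; have pp := pcharf_prime cF.
rewrite -(@box_logn _ _ _ _ `|\det (binom_mx int a b n)|%N) //; last first.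
  by have /(congr1 absz) := binom_mx_int_det a b n; rewrite !abszM !natz.
have -> : binom_mx F a b n = map_mx intr (binom_mx int a b n).
  by apply/matrixP => i j; rewrite !mxE rmorph_nat.
by rewrite unitmxE det_map_mx unitfE -(dvdz_pcharf cF).
Qed.

(** * Ranks of powers for a unipotent Jordan form *)

Lemma nilp_blockX (F : fieldType) l k :
  nilp_block F l ^+ k = \matrix_(i, j) (j == i + k :> nat)%N%:R.
Proof.
elim: k => [|k IH]; apply/matrixP => i j.
  by rewrite expr0 !mxE addn0 eq_sym.
rewrite exprS IH !mxE.
have [li|il] := leqP l i.+1.
  rewrite big1 => [|t _]; last by rewrite !mxE (ltn_eqF (leq_trans (ltn_ord t) li)) mul0r.
  by rewrite ltn_eqF // addnS -addSn ltn_addr // (leq_trans (ltn_ord j)).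
rewrite (bigD1 (Ordinal il)) //= !mxE eqxx mul1r addSnnS big1 ?addr0 // => t.
by rewrite -(inj_eq val_inj) !mxE /= => /negbTE ->; rewrite mul0r.
Qed.

(** Only the first [l - k] rows of the power [N] are nonzero, and [N *m N^T] is [pid_mx (l - k)];
    these give the two bounds. *)
Lemma rank_nilp_blockX (F : fieldType) l k : \rank (nilp_block F l ^+ k) = (l - k)%N.
Proof.
have lkl : (l - k <= l)%N by apply: leq_subr.
set N := _ ^+ k; apply/eqP; rewrite eqn_leq; apply/andP; split.
  have -> : N = pid_mx (l - k) *m N.
    apply/matrixP => i j; rewrite mxE (bigD1 i) //= big1 => [|t ti].
      rewrite addr0 /N nilp_blockX !mxE eqxx /=; case: ltnP; rewrite ?mul1r // => lki.
      by rewrite mul0r ltn_eqF //; move: (ltn_ord j); lia.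
    by rewrite mxE (eq_sym (i : nat)) (inj_eq val_inj) (negbTE ti) mul0r.
  by apply: leq_trans (mxrankM_maxl _ _) _; rewrite rank_pid_mx.
rewrite -{1}(@rank_pid_mx F l l (l - k)) //.
have -> : pid_mx (l - k) = N *m N^T; last exact: mxrankM_maxl.
apply/matrixP => i j; rewrite !mxE /N nilp_blockX.
have [ik|ik] := ltnP i (l - k); rewrite ?andbT ?andbF.
  have ikl : (i + k < l)%N by lia.
  rewrite (bigD1 (Ordinal ikl)) //= !mxE eqxx mul1r /= eqn_add2r big1 ?addr0 // => t.
  by rewrite !mxE -(inj_eq val_inj) /= => /negbTE ->; rewrite mul0r.
rewrite big1 // => t _; rewrite !mxE ltn_eqF ?mul0r //.
by move: (ltn_ord t); lia.
Qed.

Lemma mxdiagX (F : fieldType) k (p : 'I_k -> nat) (B : forall i, 'M[F]_(p i)) n :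
  (\mxdiag_i B i) ^+ n = \mxdiag_i (B i ^+ n).
Proof.
elim: n => [|n IH].
  by rewrite expr0 -[RHS]/(\mxdiag_i (1%:M : 'M[F]_(p i))) mxdiagZ.
rewrite exprS IH -[LHS]/(\mxdiag_i B i *m \mxdiag_i (B i ^+ n)) mul_mxdiag_mxblock.
apply: eq_mxblock => i j; have [->|_] := eqVneq; last by rewrite mulmx0.
by rewrite !conform_mx_id exprS.
Qed.

Lemma unipotent_jordan_form_rank (F : fieldType) n k (A : 'M[F]_n) (lam : 'I_k -> nat) t :
  unipotent_jordan_form A lam ->
  \rank ((A - 1%:M) ^+ t) = (\sum_i (lam i - t))%N.
Proof.
case=> _ _ [e [P Pu /(simmxRL Pu)]].
have PAP : P *m (A - 1%:M) *m invmx P = P *m A *m invmx P - 1%:M.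
  by rewrite mulmxBr mulmxBl mulmx1 mulmxV.
have -> : \rank ((A - 1%:M) ^+ t) = \rank ((P *m A *m invmx P - 1%:M) ^+ t).
  have -> : (P *m A *m invmx P - 1%:M) ^+ t = P *m (A - 1%:M) ^+ t *m invmx P.
    rewrite -PAP; elim: t => [|t IH]; first by rewrite !expr0 mulmx1 mulmxV.
    rewrite !exprS IH -!mulmxE !mulmxA; congr (_ *m _ *m _).
    by rewrite -[LHS]mulmxA mulVmx ?mulmx1.
  rewrite mxrankMfree ?row_free_unit ?unitmx_inv //.
  by rewrite eqmxMfull // row_full_unit.
move=> <- {PAP}; case: n / e A P Pu => A P Pu; rewrite castmx_id -mxdiagZ -mxdiagB.
rewrite mxdiagX rank_mxdiag; apply: eq_bigr => i _.
by rewrite /jordan_block addrC addKr rank_nilp_blockX.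
Qed.

(** * Powers of the nilpotent part in the monomial basis *)

Definition tens_nilp (F : fieldType) r s : 'M[F]_(r * s) :=
  jordan_block F r *t jordan_block F s - 1%:M.

Definition monom_row r s (t : 'I_(r * s)) : nat := (mxtens_unindex t).1.
Definition monom_col r s (t : 'I_(r * s)) : nat := (mxtens_unindex t).2.
Definition monom_deg r s (t : 'I_(r * s)) : nat := (monom_row t + monom_col t)%N.

(* The coefficient of x^i' y^j' in x^i y^j (x+y+xy)^k, before truncation. *)
Fixpoint tens_nilp_coef (F : fieldType) k (i j i' j' : nat) : F :=
  if k is k.+1 then
    tens_nilp_coef F k i.+1 j i' j' + tens_nilp_coef F k i j.+1 i' j'
    + tens_nilp_coef F k i.+1 j.+1 i' j'
  else ((i == i') && (j == j'))%:R.

Lemma tens_nilp_coef_lt (F : fieldType) k i j i' j' :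
  ((i' < i) || (j' < j))%N -> tens_nilp_coef F k i j i' j' = 0.
Proof.
elim: k i j => [|k IH] i j /= lt; last by rewrite !IH ?addr0 //; lia.
by rewrite (_ : _ && _ = false) //; lia.
Qed.

Lemma tens_nilp_coef_deg_lt (F : fieldType) k i j i' j' :
  (i' + j' < i + j + k)%N -> tens_nilp_coef F k i j i' j' = 0.
Proof.
elim: k i j => [|k IH] i j /= lt; last by rewrite !IH ?addr0 //; lia.
by rewrite (_ : _ && _ = false) //; lia.
Qed.

Lemma tens_nilp_coef_deg_eq (F : fieldType) k i j i' j' :
  (i' + j' = i + j + k)%N ->
  tens_nilp_coef F k i j i' j' = (if (i <= i')%N then 'C(k, i' - i) else 0%N)%:R.
Proof.
elim: k i j => [|k IH] i j /= e.
  have [le|lt] := leqP i i'; last by rewrite gtn_eqF.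
  by rewrite bin0n; congr (nat_of_bool _)%:R; lia.
rewrite [X in _ + _ + X]tens_nilp_coef_deg_lt ?addr0; last by lia.
rewrite !IH; try lia.
have [lt|le] := ltnP i i'.
  by rewrite (ltnW lt) -natrD -(subnSK lt) binS addnC.
have [ge|lt] := leqP i i'; last by rewrite addr0.
by rewrite (_ : i' - i = 0)%N ?bin0 ?add0r //; lia.
Qed.

(** The hypothesis on [G] covers monomials killed by truncation, which the sum omits. *)
Lemma sum_monom_delta (F : fieldType) r s (G : nat -> nat -> F) a b :
  ((r <= a)%N || (s <= b)%N -> G a b = 0) ->
  \sum_(t < r * s) ((monom_row t == a) && (monom_col t == b))%:R
     * G (monom_row t) (monom_col t) = G a b.
Proof.
move=> G0; have [ar|ra] := ltnP a r; last first.
  rewrite (G0 _) ?ra // big1 // => t _.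
  by rewrite ltn_eqF ?mul0r // (leq_trans _ ra) // ltn_ord.
have [bs|sb] := ltnP b s; last first.
  rewrite (G0 _) ?sb ?orbT // big1 // => t _.
  by rewrite [X in _ && X]ltn_eqF ?andbF ?mul0r // (leq_trans _ sb) // ltn_ord.
rewrite (bigD1 (mxtens_index (Ordinal ar, Ordinal bs))) //= big1 ?addr0.
  by rewrite /monom_row /monom_col mxtens_indexK /= !eqxx mul1r.
move=> t tab; case: andP => [[/eqP ta /eqP tb]|_]; last by rewrite mul0r.
case/eqP: tab; rewrite -[t]mxtens_unindexK; congr mxtens_index.
move: ta tb; rewrite /monom_row /monom_col; case: (mxtens_unindex t) => x y /= ta tb.
by congr pair; apply: val_inj.
Qed.

Lemma tens_nilpE (F : fieldType) r s (p t : 'I_(r * s)) :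
  tens_nilp F r s p t =
  let: (i, j) := (monom_row p, monom_col p) in
  ((monom_row t == i.+1) && (monom_col t == j))%:R
  + ((monom_row t == i) && (monom_col t == j.+1))%:R
  + ((monom_row t == i.+1) && (monom_col t == j.+1))%:R.
Proof.
rewrite -[p]mxtens_unindexK -[t]mxtens_unindexK.
case: (mxtens_unindex p) (mxtens_unindex t) => [i j] [i' j'].
rewrite /tens_nilp /monom_row /monom_col !mxE !mxtens_indexK /=.
rewrite (can_eq (@mxtens_indexK r s)) xpair_eqE -!(inj_eq val_inj) /=.
rewrite (eq_sym (i : nat)) (eq_sym (j : nat)).
have [-> | _] := eqVneq (i' : nat) i; have [-> | _] := eqVneq (j' : nat) j;
  rewrite ?(ltn_eqF (ltnSn _)) ?add0r ?addr0 ?mulr0 ?mul0r ?mulr1 ?mul1r ?subrr ?subr0 //.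
  by rewrite andbT andbF addr0.
by rewrite andbF add0r -natrM mulnb.
Qed.

Lemma tens_nilpX (F : fieldType) r s k (p q : 'I_(r * s)) :
  (tens_nilp F r s ^+ k) p q =
  tens_nilp_coef F k (monom_row p) (monom_col p) (monom_row q) (monom_col q).
Proof.
elim: k p => [|k IH] p.
  rewrite expr0 mxE /= -[p]mxtens_unindexK -[q]mxtens_unindexK.
  case: (mxtens_unindex p) (mxtens_unindex q) => [i j] [i' j'].
  rewrite /monom_row /monom_col !mxtens_indexK.
  by rewrite (can_eq (@mxtens_indexK r s)) xpair_eqE.
rewrite exprS mxE /=.
under eq_bigr => t _ do rewrite IH tens_nilpE /= !mulrDl.
(* Exponents never decrease, so a path that leaves the box cannot return to [q]. *)
have lt a b : (r <= a)%N || (s <= b)%N ->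
    tens_nilp_coef F k a b (monom_row q) (monom_col q) = 0.
  move=> ab; apply: tens_nilp_coef_lt.
  have := ltn_ord (mxtens_unindex q).1; have := ltn_ord (mxtens_unindex q).2.
  by rewrite /monom_row /monom_col; lia.
pose G a b := tens_nilp_coef F k a b (monom_row q) (monom_col q).
by rewrite !big_split /= !(@sum_monom_delta _ _ _ G) //; apply: lt.
Qed.

(** * Matrices on a graded basis *)

Section GradedMatrix.
Variables (F : fieldType) (N : nat) (deg : 'I_N -> nat).
Implicit Types (P Q : pred nat) (M : 'M[F]_N).

Definition deg_proj P : 'M[F]_N := diag_mx (\row_t (P (deg t))%:R).

Definition deg_card P : nat := (\sum_t P (deg t))%N.

Definition raises_deg k M := forall p q, (deg q < deg p + k)%N -> M p q = 0.

Lemma deg_proj_mull P n (A : 'M_(N, n)) i j :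
  (deg_proj P *m A) i j = (P (deg i))%:R * A i j.
Proof. by rewrite mul_diag_mx !mxE. Qed.

Lemma deg_proj_mulr P n (A : 'M_(n, N)) i j :
  (A *m deg_proj P) i j = A i j * (P (deg j))%:R.
Proof. by rewrite mul_mx_diag !mxE. Qed.

Lemma deg_projD P Q (R : pred nat) : (forall d, P d + Q d = R d :> nat)%N ->
  deg_proj P + deg_proj Q = deg_proj R.
Proof.
move=> PQR; apply/matrixP => i j; rewrite !mxE -mulrnDl.
by congr (_ *+ _); rewrite -natrD PQR.
Qed.

Lemma deg_cardD P Q (R : pred nat) : (forall d, P d + Q d = R d :> nat)%N ->
  (deg_card P + deg_card Q = deg_card R)%N.
Proof.
by move=> PQR; rewrite -big_split; apply: eq_bigr => t _; apply: PQR.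
Qed.

Lemma deg_projT : deg_proj predT = 1%:M.
Proof. by apply/matrixP => i j; rewrite !mxE. Qed.

Lemma rank_deg_proj_le P : (\rank (deg_proj P) <= deg_card P)%N.
Proof.
have -> : deg_proj P = \sum_t (P (deg t))%:R *: delta_mx t t.
  apply/matrixP => i j; rewrite summxE (bigD1 i) //= big1 => [|t ti]; last first.
    by rewrite !mxE eq_sym (negbTE ti) mulr0.
  by rewrite !mxE eqxx addr0 eq_sym mulr_natr.
rewrite /deg_card; elim/big_rec2: _ => [|t A n _ IH]; first by rewrite mxrank0.
apply: leq_trans (mxrank_add _ _) (leq_add _ IH).
by case: (P _); rewrite ?scale1r ?scale0r ?mxrank0 ?mxrank_delta.
Qed.

Lemma raises_deg_proj k M a : raises_deg k M ->
  deg_proj (leq a) *m M = deg_proj (leq a) *m M *m deg_proj (leq (a + k)).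
Proof.
move=> rM; apply/matrixP => i j; rewrite deg_proj_mulr deg_proj_mull.
have [ai|ia] := leqP a (deg i); last by rewrite !mul0r.
have [_|lt] := leqP (a + k) (deg j); first by rewrite mulr1.
by rewrite rM ?mulr0 ?mul0r //; apply: leq_trans lt _; rewrite leq_add2r.
Qed.

Lemma deg_proj_ge_split d : deg_proj (leq d) = deg_proj (pred1 d) + deg_proj (leq d.+1).
Proof.
by symmetry; apply: deg_projD => e /=; case: ltngtP.
Qed.

Lemma deg_proj_lt_split d : 1%:M = deg_proj (gtn d) + deg_proj (leq d).
Proof.
by rewrite -deg_projT; symmetry; apply: deg_projD => e /=; case: ltnP.
Qed.

Lemma raises_deg_proj_eq k M d : raises_deg k M ->
  deg_proj (leq d) *m M *m deg_proj (pred1 (d + k)%N)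
  = deg_proj (pred1 d) *m M *m deg_proj (pred1 (d + k)%N).
Proof.
move=> rM; apply/matrixP => i j; rewrite !deg_proj_mulr !deg_proj_mull /=.
have [dj|_] := eqVneq (deg j) (d + k)%N; last by rewrite !mulr0.
by case: ltngtP => // di; rewrite rM ?mulr0 // dj ltn_add2r.
Qed.

(** [M] splits into its part from degrees below [d], its block from [d] to [d + k], and its part
    from degrees at least [d] to degrees above [d + k]. *)
Lemma rank_raises_deg k M d : raises_deg k M ->
  (\rank M <= deg_card (gtn d)
     + \rank (deg_proj (pred1 d) *m M *m deg_proj (pred1 (d + k)%N))
     + deg_card (leq (d + k).+1))%N.
Proof.
move=> rM.
have -> : \rank M = \rank ((deg_proj (gtn d) *m M
   + deg_proj (pred1 d) *m M *m deg_proj (pred1 (d + k)%N)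
   + deg_proj (leq d) *m M *m deg_proj (leq (d + k).+1))%R).
  congr mxrank; rewrite -raises_deg_proj_eq // -addrA -mulmxDr.
  rewrite -deg_proj_ge_split.
  by rewrite -raises_deg_proj // -mulmxDl -deg_proj_lt_split mul1mx.
apply: leq_trans (mxrank_add _ _) (leq_add (leq_trans (mxrank_add _ _) _) _).
  by rewrite leq_add2r (leq_trans (mxrankM_maxl _ _)) // rank_deg_proj_le.
by rewrite (leq_trans (mxrankM_maxr _ _)) // rank_deg_proj_le.
Qed.

(** The degree [e + k] part of [K *m M] comes from the degree [e] part of [K] alone, so injectivity
    of that block kills the latter. *)
Lemma deg_proj_ker k M e m (K : 'M[F]_(m, N)) : raises_deg k M ->
  (forall w : 'M[F]_(m, N),
     w *m (deg_proj (pred1 e) *m M *m deg_proj (pred1 (e + k)%N)) = 0 ->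
     w *m deg_proj (pred1 e) = 0) ->
  K *m M = 0 -> K *m deg_proj (leq e) = K -> K *m deg_proj (leq e.+1) = K.
Proof.
move=> rM inj KM Ke; rewrite -[RHS]Ke (deg_proj_ge_split e) mulmxDr inj ?add0r //.
by rewrite -raises_deg_proj_eq // !mulmxA Ke KM mul0mx.
Qed.

Section Enumeration.
Variables (n : nat) (P : pred nat) (f : 'I_n -> 'I_N).
Hypotheses (fI : injective f) (fP : forall t, P (deg t) = (t \in codom f)).

Lemma deg_card_codom : deg_card P = n.
Proof.
rewrite /deg_card -[RHS]card_ord -(card_codom fI) -sum1_card [RHS]big_mkcond.
by apply: eq_bigr => t _; rewrite fP; case: (_ \in _).
Qed.

(** Factors the projection through a space of dimension [n], so that a graded block can be traded
    for an [n] by [n] submatrix. *)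
Lemma deg_proj_codom :
  deg_proj P = (rowsub f 1%:M)^T *m rowsub f (1%:M : 'M[F]_N).
Proof.
apply/matrixP => i j; rewrite !mxE fP; case: codomP => [[t ->]|nf].
  rewrite (bigD1 t) //= big1 => [|u ut]; rewrite !mxE ?eqxx ?mul1r ?addr0 //.
  by rewrite (inj_eq fI) (negbTE ut) mul0r.
rewrite mul0rn big1 // => u _; rewrite !mxE; case: eqP => [fu|_]; last by rewrite mul0r.
by case: nf; exists u.
Qed.

Lemma rowsub1K : rowsub f 1%:M *m (rowsub f (1%:M : 'M[F]_N))^T = 1%:M.
Proof.
apply/matrixP => i j; rewrite !mxE (bigD1 (f i)) //= big1 => [|t ti].
  by rewrite !mxE eqxx mul1r addr0 (inj_eq fI) eq_sym.
by rewrite !mxE eq_sym (negbTE ti) mul0r.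
Qed.
End Enumeration.

Section Block.
Variables (n : nat) (P Q : pred nat) (f g : 'I_n -> 'I_N) (M : 'M[F]_N).
Hypotheses (fI : injective f) (fP : forall t, P (deg t) = (t \in codom f)).
Hypotheses (gI : injective g) (gQ : forall t, Q (deg t) = (t \in codom g)).

Lemma mxsub_block : mxsub f g M = rowsub f 1%:M *m M *m (rowsub g 1%:M)^T.
Proof.
by rewrite trmx_mxsub trmx1 mulmx_colsub mulmx1 mul_rowsub_mx mul1mx mxsubcr.
Qed.

Lemma rank_deg_block : (\rank (deg_proj P *m M *m deg_proj Q) <= \rank (mxsub f g M))%N.
Proof.
rewrite (deg_proj_codom fI fP) (deg_proj_codom gI gQ) mxsub_block.
rewrite -2!mulmxA; apply: leq_trans (mxrankM_maxr _ _) _.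
by rewrite !mulmxA; apply: mxrankM_maxl.
Qed.

Lemma deg_block_inj m (w : 'M[F]_(m, N)) : mxsub f g M \in unitmx ->
  w *m (deg_proj P *m M *m deg_proj Q) = 0 -> w *m deg_proj P = 0.
Proof.
rewrite (deg_proj_codom fI fP) (deg_proj_codom gI gQ) mxsub_block => U.
move/(congr1 (mulmx^~ (rowsub g 1%:M)^T)); rewrite mul0mx !mulmxA.
rewrite -[_ *m rowsub g _ *m _]mulmxA rowsub1K // mulmx1.
rewrite -!mulmxA (mulmxA (rowsub f _)) (mulmxA w).
move/(congr1 (mulmx^~ (invmx (rowsub f 1%:M *m M *m (rowsub g 1%:M)^T)))).
by rewrite mul0mx mulmxK // mulmxA => ->; rewrite mul0mx.
Qed.
End Block.
End GradedMatrix.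

(** * The square blocks between opposite degrees *)

Section TensorBlocks.
Variables (F : fieldType) (r s n : nat).
Hypotheses (n0 : (0 < n)%N) (nr : (n <= r)%N) (rs : (r <= s)%N).
Local Notation deg := (@monom_deg r s).

Lemma low_row_lt (i : 'I_n) : (i < r)%N. Proof. exact: leq_trans nr. Qed.
Lemma low_col_lt (i : 'I_n) : (n.-1 - i < s)%N. Proof. by lia. Qed.
Lemma high_row_lt (i : 'I_n) : (r - n + i < r)%N. Proof. by move: (ltn_ord i); lia. Qed.
Lemma high_col_lt (i : 'I_n) : (s.-1 - i < s)%N. Proof. by lia. Qed.

(** These are [x^i y^(n-1-i)], of degree [n-1]; the high ones are [x^(r-n+i) y^(s-1-i)], of degree
    [r+s-1-n]. As [n <= r <= s], each list exhausts its degree. *)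
Definition low_monom (i : 'I_n) : 'I_(r * s) :=
  mxtens_index (Ordinal (low_row_lt i), Ordinal (low_col_lt i)).
Definition high_monom (i : 'I_n) : 'I_(r * s) :=
  mxtens_index (Ordinal (high_row_lt i), Ordinal (high_col_lt i)).

Lemma low_monom_inj : injective low_monom.
Proof. by move=> i j /(can_inj (@mxtens_indexK _ _)) [ij _]; apply: val_inj. Qed.

Lemma high_monom_inj : injective high_monom.
Proof.
move=> i j /(can_inj (@mxtens_indexK _ _)) [/addnI ij _]; exact: val_inj.
Qed.

Lemma monom_codom (f : 'I_n -> 'I_(r * s)) (t : 'I_(r * s)) (i : 'I_n) :
  monom_row t = monom_row (f i) -> monom_col t = monom_col (f i) -> t \in codom f.
Proof.
move=> e1 e2; apply/codomP; exists i; rewrite -[t]mxtens_unindexK -[f i]mxtens_unindexK.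
congr mxtens_index; move: e1 e2; rewrite /monom_row /monom_col.
case: (mxtens_unindex t) (mxtens_unindex (f i)) => [x y] [x' y'] /= e1 e2.
by congr pair; apply: val_inj.
Qed.

Lemma low_monomP t : pred1 n.-1 (deg t) = (t \in codom low_monom).
Proof.
apply/eqP/idP => [dt|/codomP[i ->]]; last first.
  rewrite /monom_deg /monom_row /monom_col mxtens_indexK /=.
  by move: (ltn_ord i); lia.
have tn : (monom_row t < n)%N by move: dt; rewrite /monom_deg; lia.
apply: (@monom_codom _ _ (Ordinal tn));
  rewrite /low_monom /monom_row /monom_col mxtens_indexK //=.
by move: dt; rewrite /monom_deg /monom_row /monom_col /=; lia.
Qed.

Lemma high_monomP t : pred1 (n.-1 + (r + s - 2 * n))%N (deg t) = (t \in codom high_monom).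
Proof.
apply/eqP/idP => [dt|/codomP[i ->]]; last first.
  rewrite /monom_deg /monom_row /monom_col mxtens_indexK /=.
  by move: (ltn_ord i); lia.
have rt := ltn_ord (mxtens_unindex t).1.
have st := ltn_ord (mxtens_unindex t).2.
have tn : (s.-1 - monom_col t < n)%N.
  by move: dt rt st; rewrite /monom_deg /monom_row /monom_col /=; lia.
apply: (@monom_codom _ _ (Ordinal tn));
  rewrite /high_monom /monom_row /monom_col mxtens_indexK /=;
  by move: dt rt st; rewrite /monom_deg /monom_row /monom_col /=; lia.
Qed.

Lemma tens_nilpX_block :
  mxsub low_monom high_monom (tens_nilp F r s ^+ (r + s - 2 * n))
  = binom_mx F (r - n) (s - n) n.
Proof.
apply/matrixP => i j; rewrite !mxE tens_nilpX /monom_row /monom_col !mxtens_indexK /=.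
rewrite tens_nilp_coef_deg_eq; last by move: (ltn_ord i) (ltn_ord j); lia.
by have -> : (r + s - 2 * n = r - n + (s - n))%N by lia.
Qed.
End TensorBlocks.

(** * Bounds on the ranks of powers *)

Lemma raises_deg_tens_nilpX (F : fieldType) r s k :
  raises_deg (@monom_deg r s) k (tens_nilp F r s ^+ k).
Proof. by move=> p q lt; rewrite tens_nilpX tens_nilp_coef_deg_lt. Qed.

Lemma deg_card_low r s n : (n <= r)%N -> (r <= s)%N ->
  (2 * deg_card (@monom_deg r s) (gtn n) = n * n.+1)%N.
Proof.
move=> nr rs; elim: n nr => [|n IH] nr; first by rewrite /deg_card big1.
rewrite -(@deg_cardD _ _ (gtn n) (pred1 n)); last by move=> d /=; lia.
rewrite mulnDr IH 1?ltnW //.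
by rewrite (deg_card_codom (@low_monom_inj _ _ _ (ltn0Sn n) nr rs) (low_monomP _ _ _)); lia.
Qed.

Lemma deg_card_high r s n : (n <= r)%N -> (r <= s)%N ->
  (2 * deg_card (@monom_deg r s) (leq (r + s - n.+1)) = n * n.+1)%N.
Proof.
move=> nr rs; elim: n nr => [|n IH] nr.
  rewrite /deg_card big1 // => t _.
  move: (ltn_ord (mxtens_unindex t).1) (ltn_ord (mxtens_unindex t).2).
  by rewrite /monom_deg /monom_row /monom_col; lia.
rewrite -(@deg_cardD _ _ (leq (r + s - n.+1)) (pred1 (n + (r + s - 2 * n.+1)))%N).
  2: by move=> d /=; lia.
rewrite mulnDr IH 1?ltnW //.
by rewrite (deg_card_codom (@high_monom_inj _ _ _ (ltn0Sn n) nr rs) (high_monomP _ _ _)); lia.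
Qed.

(** Splitting at degree [n - 1], each outer term counts [1 + ... + (n - 1)] monomials, hence
    [n * n.-1] together. *)
Lemma rank_tens_nilpX_le (F : fieldType) r s n :
  (0 < n <= r)%N -> (r <= s)%N ->
  (\rank (tens_nilp F r s ^+ (r + s - 2 * n))
    <= n * n.-1 + \rank (binom_mx F (r - n) (s - n) n))%N.
Proof.
move=> /andP[n0 nr] rs; have nr' : (n.-1 <= r)%N by lia.
have le := @rank_raises_deg _ _ _ _ _ n.-1 (@raises_deg_tens_nilpX F r s (r + s - 2 * n)).
have le' := @rank_deg_block _ _ _ _ _ _ _ _ (tens_nilp F r s ^+ (r + s - 2 * n))
  (@low_monom_inj _ _ _ n0 nr rs) (low_monomP n0 nr rs)
  (@high_monom_inj _ _ _ n0 nr rs) (high_monomP n0 nr rs).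
rewrite tens_nilpX_block in le'.
have := @deg_card_high r s n.-1 nr' rs; have := @deg_card_low r s n.-1 nr' rs.
have -> : (r + s - n.-1.+1 = (n.-1 + (r + s - 2 * n)).+1)%N by lia.
rewrite (prednK n0) [(n.-1 * n)%N]mulnC => c1 c2; apply: (leq_trans le).
rewrite addnAC leq_add //.
by move: c1 c2; move: (n * n.-1)%N; lia.
Qed.

Lemma ker_tens_nilpX (F : fieldType) r s n m (K : 'M[F]_(m, r * s)) :
  (n <= r)%N -> (r <= s)%N ->
  (forall e, (0 < e <= n)%N -> binom_mx F (r - e) (s - e) e \in unitmx) ->
  K *m tens_nilp F r s ^+ (r + s - 2 * n) = 0 ->
  K *m deg_proj F (@monom_deg r s) (leq n) = K.
Proof.
move=> nr rs U KT; suff H e : (e <= n)%N -> K *m deg_proj F (@monom_deg r s) (leq e) = K.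
  exact: H.
elim: e => [|e IH] en.
  by rewrite (_ : leq 0 = predT) // deg_projT mulmx1.
have er : (e.+1 <= r)%N by apply: leq_trans nr.
apply: (deg_proj_ker (@raises_deg_tens_nilpX F r s (r + s - 2 * e.+1))).
- move=> w; apply: (deg_block_inj
    (@low_monom_inj _ _ _ (ltn0Sn e) er rs) (low_monomP (ltn0Sn e) er rs)
    (@high_monom_inj _ _ _ (ltn0Sn e) er rs) (high_monomP (ltn0Sn e) er rs)).
  by rewrite tens_nilpX_block // U.
(* For [e < n] this exponent is at least the given one, so [K] is killed by this power too. *)
- have -> : (r + s - 2 * e.+1 = r + s - 2 * n + 2 * (n - e.+1))%N by lia.
  by rewrite exprD -mulmxE mulmxA KT mul0mx.
- by apply: IH; apply: ltnW.
Qed.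

(** The drop equals the codimension of [im T + ker T^k]. That sum lies in the image of the degrees
    below [n - 1] plus all degrees at least [n], so its codimension is at least the number [n] of
    monomials of degree [n - 1]. *)
Lemma rank_tens_nilpX_drop (F : fieldType) r s n :
  (0 < n <= r)%N -> (r <= s)%N ->
  (forall e, (0 < e <= n)%N -> binom_mx F (r - e) (s - e) e \in unitmx) ->
  (n + \rank (tens_nilp F r s ^+ (r + s - 2 * n).+1)
   <= \rank (tens_nilp F r s ^+ (r + s - 2 * n)))%N.
Proof.
move=> /andP[n0 nr] rs U; set k := (r + s - 2 * n)%N; set T := tens_nilp F r s.
pose dp := deg_proj F (@monom_deg r s).
have kerT : (kermx (T ^+ k) <= dp (leq n))%MS.
  by rewrite -(ker_tens_nilpX nr rs U (mulmx_ker _)) submxMl.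
have imT : (T <= dp (gtn n.-1) *m T + dp (leq n))%MS.
  rewrite -{1}[T]mul1mx (deg_proj_lt_split F (@monom_deg r s) n.-1) mulmxDl.
  rewrite addmx_sub_adds ?submx_refl //.
  have := @raises_deg_tens_nilpX F r s 1; rewrite expr1 => /raises_deg_proj ->.
  by rewrite addn1 prednK // submxMl.
have sumT : (T + kermx (T ^+ k) <= dp (gtn n.-1) *m T + dp (leq n))%MS.
  by rewrite addsmx_sub imT (submx_trans kerT) ?addsmxSr.
have bound := leq_trans (mxrankS sumT) (mxrank_adds_leqif _ _).1.
have lo := leq_trans (mxrankM_maxl (dp (gtn n.-1)) T) (rank_deg_proj_le _ _ _).
have hi := rank_deg_proj_le F (@monom_deg r s) (leq n).
have eq1 := mxrank_mul_ker T (T ^+ k).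
have eq2 := mxrank_sum_cap T (kermx (T ^+ k)).
have eq3 := mxrank_ker (T ^+ k).
have cn := deg_card_codom (@low_monom_inj _ _ _ n0 nr rs) (low_monomP n0 nr rs).
pose dc := deg_card (@monom_deg r s).
have c1 : (dc (gtn n.-1) + dc (pred1 n.-1) = dc (gtn n))%N.
  by apply: deg_cardD => d /=; lia.
have c2 : (dc (gtn n) + dc (leq n) = dc predT)%N.
  by apply: deg_cardD => d /=; lia.
have c3 : dc predT = (r * s)%N.
  by rewrite /dc /deg_card sum_nat_const card_ord muln1.
have rk := rank_leq_row (T ^+ k).
rewrite exprS -mulmxE.
move: bound lo hi eq1 eq2 eq3 cn c1 c2 c3 rk; rewrite /dp /dc; lia.
Qed.

(** * From ranks to the partition *)

Lemma standard_partition_nat r s (lam : 'I_r -> nat) : (r <= s)%N ->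
  standard_partition s lam <-> forall i : 'I_r, lam i = (r + s - 1 - 2 * i)%N.
Proof.
by move=> rs; split=> H i; move: (H i) (ltn_ord i); rewrite /standard_partition /=; lia.
Qed.

Lemma tensor_pi_is_idP r s (lam : 'I_r -> nat) :
  standard_partition s lam <-> tensor_pi_is_id s lam.
Proof.
by split=> H i; move: (H i); rewrite /tensor_pi_is_id /tensor_pi /=; lia.
Qed.

(** The first [n] odd numbers; truncation makes the terms with [i >= n] zero. *)
Lemma sum_odd_truncated r n : (n <= r)%N -> (\sum_(i < r) (2 * n - 1 - 2 * i) = n * n)%N.
Proof.
elim: r n => [|r IH] [|n] nr //; first by rewrite big_ord0.
  by rewrite big1 // => i _; lia.
rewrite big_ord_recl /=.
under eq_bigr => i _.
  have -> : (2 * n.+1 - 1 - 2 * bump 0 i = 2 * n - 1 - 2 * i)%N by rewrite /bump; lia.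
  over.
by rewrite IH //; lia.
Qed.

Lemma sum_standard_parts r s : (r <= s)%N ->
  (\sum_(i < r) (r + s - 1 - 2 * i) = r * s)%N.
Proof.
move=> rs; under eq_bigr => i _.
  have -> : (r + s - 1 - 2 * i = (s - r) + (2 * r - 1 - 2 * i))%N.
    by move: (ltn_ord i); lia.
  over.
rewrite big_split sum_nat_const card_ord sum_odd_truncated //=.
by rewrite -mulnDr subnK.
Qed.

(** The difference of sums counts the parts exceeding [k]; if [lam j <= k], monotonicity leaves at
    most [j] of them. *)
Lemma nonincreasing_ge r (lam : 'I_r -> nat) k (j : 'I_r) :
  (forall i i' : 'I_r, (i <= i')%N -> (lam i' <= lam i)%N) ->
  (j < \sum_i (lam i - k) - \sum_i (lam i - k.+1))%N -> (k < lam j)%N.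
Proof.
move=> mono; apply: contraTT; rewrite -!leqNgt => ljk.
rewrite leq_subLR addnC.
have le i : (lam i - k <= (i < j) + (lam i - k.+1))%N.
  have [ij|ji] := ltnP i j; first by lia.
  by have := mono j i ji; lia.
have L : (\sum_i (lam i - k) <= \sum_(i < r) ((i < j) + (lam i - k.+1)))%N.
  exact: leq_sum.
apply: (leq_trans L).
rewrite big_split leq_add2r /=.
rewrite -(big_mkord xpredT (fun i => (i < j) : nat)).
rewrite (@big_cat_nat _ _ _ j) ?(ltnW (ltn_ord j)) //=.
rewrite [X in (_ + X)%N]big_nat_cond [X in (_ + X)%N]big1 ?addn0; last first.
  by move=> i /andP[/andP[ji _] _]; rewrite ltnNge ji.
apply: (@leq_trans (\sum_(0 <= i < j) 1)%N).
  by apply: leq_sum => i _; apply: leq_b1.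
by rewrite sum_nat_const_nat subn0 muln1.
Qed.

Lemma standard_partition_unitmx (F : fieldType) r s (lam : 'I_r -> nat) :
  (0 < r <= s)%N -> is_tensor_partition F s lam ->
  standard_partition s lam <->
  forall n, (0 < n <= r)%N -> binom_mx F (r - n) (s - n) n \in unitmx.
Proof.
move=> /andP[r0 rs] lamP; rewrite standard_partition_nat //.
have rk k : \rank (tens_nilp F r s ^+ k) = (\sum_i (lam i - k))%N.
  exact: unipotent_jordan_form_rank lamP.
split=> [std n nr | U].
  have /andP[n0 nr'] := nr.
  have := rank_tens_nilpX_le F nr rs; rewrite rk.
  (* For the standard parts the rank is the sum of the first [n] odd numbers, [n * n], which leaves
     rank [n] for the block. *)
  under eq_bigr => i _.
    rewrite std (_ : _ - (_ - _) = 2 * n - 1 - 2 * i)%N; last by move: (ltn_ord i); lia.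
    over.
  rewrite sum_odd_truncated // -row_free_unit /row_free eqn_leq rank_leq_row.
  have -> : (n * n = n * n.-1 + n)%N by case: (n) n0 => // n' _; rewrite mulnS addnC.
  by rewrite leq_add2l.
case: lamP => mono pos [sumlam _].
have ge (i : 'I_r) : (r + s - 1 - 2 * i <= lam i)%N.
  have ir := ltn_ord i.
  have : (r + s - 2 * i.+1 < lam i)%N.
    apply: nonincreasing_ge => //; rewrite -!rk.
    have ir' : (0 < i.+1 <= r)%N by [].
    have := @rank_tens_nilpX_drop F r s i.+1 ir' rs.
    have Ui e : (0 < e <= i.+1)%N -> binom_mx F (r - e) (s - e) e \in unitmx.
      by move=> /andP[e0 ei]; apply: U; rewrite e0 (leq_trans ei).
    by move=> /(_ Ui); lia.
  by lia.
move=> i; apply/eqP; rewrite eq_sym.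
(* Both families of parts sum to [r * s], so the termwise bounds are equalities. *)
have [_ /esym] := leqif_sum (fun (i : 'I_r) (_ : true) => leqif_eq (ge i)).
by rewrite sum_standard_parts // sumlam eqxx => /forallP /(_ i).
Qed.

Local Close Scope ring_scope.
Unset Implicit Arguments.

Theorem theorem2p3 (r s p : nat) (hr : 1 <= r) (hrs : r <= s) (hp : prime p)
    (F : fieldType) (charF : p \in [pchar F]%R)
    (lam : 'I_r -> nat) (hlam : is_tensor_partition F s lam) :
  [<-> standard_partition s lam;
       tensor_pi_is_id s lam;
       standard_triple r s p].
Proof.
have rs : (0 < r <= s)%N by rewrite hr.
have piP := tensor_pi_is_idP s lam.
have stdP : standard_partition s lam <-> standard_triple r s p.
  rewrite (standard_partition_unitmx rs hlam) (standard_tripleP hp rs).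
  have e1 e : 0 < e -> 1 < p ^ e.
    by move=> e0; rewrite -(expn0 p) ltn_exp2l ?prime_gt1.
  split=> [U e e0 | S n nr].
    apply/(shape_goodP (e1 e e0) rs) => n nr.
    by apply/(unitmx_binom_mx _ _ _ charF): e e0; exact: U.
  apply/(unitmx_binom_mx _ _ _ charF) => e e0.
  by apply: (shape_goodP (e1 e e0) rs).1 => //; apply: S.
by tfae; rewrite -?piP -?stdP.
Qed.
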